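(* Let $H:\mathbb{R}\times\mathbb{T}\times\mathbb{R}\to\mathbb{R}$ be defined by $$H(x,y,p):=-f(x)-W(y)+\frac{|p|^2}{2},$$ where $f:\mathbb{R}\to\mathbb{R}$ is given by $f(x)=|x|^{1/4}$ if $|x|\le1$ and $f(x)=1$ if $|x|>1$, and $W:\mathbb{T}\to\mathbb{R}$ is given by $W(y)=\frac12-|y|$ for $y\in\left[-\frac12,\frac12\right]$ (extended $1$-periodically). For $\epsilon>0$, let $u^\epsilon$ be the viscosity solution to $$u^\epsilon_t+H\left(x,\frac{x}{\epsilon},Du^\epsilon\right)=0\ \text{ in }\mathbb{R}\times(0,\infty),\qquad u^\epsilon(x,0)=0\ \text{ on }\mathbb{R},$$ and let $u$ be the viscosity solution to $$u_t+\overline{H}(x,Du)=0\ \text{ in }\mathbb{R}\times(0,\infty),\qquad u(x,0)=0\ \text{ on }\mathbb{R},$$ where $\overline{H}$ is the effective Hamiltonian of $H$. Then, for all $\epsilon\in(0,2^{-80})$, $$u^\epsilon(0,1)-u(0,1)\ge\frac{1}{32}\epsilon^{1/4}.$$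
   Context: $\mathbb{T}=\mathbb{R}/\mathbb{Z}$; functions on $\mathbb{T}$ are identified with $1$-periodic functions on $\mathbb{R}$. Effective Hamiltonian: for each $(x,p)\in\mathbb{R}\times\mathbb{R}$, $\overline{H}(x,p)$ is the unique real constant for which the cell problem $H(x,y,p+Dv(y))=\overline{H}(x,p)$ for $y\in\mathbb{T}$ has a continuous (periodic) viscosity solution $v:\mathbb{T}\to\mathbb{R}$. Solutions of the Cauchy problems are viscosity solutions, unique in the class of functions that are bounded and uniformly continuous on $\mathbb{R}\times[0,T]$ for every $T>0$. *)

(* Defs.v *)
From HB Require Import structures.
From mathcomp Require Import all_boot all_order all_algebra.
From mathcomp Require Import all_classical all_reals all_analysis.
From mathcomp Require Import ring lra.
Import Order.TTheory GRing.Theory Num.Theory.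
Import numFieldNormedType.Exports.
Set Implicit Arguments.
Unset Strict Implicit.
Unset Printing Implicit Defensive.
Local Open Scope classical_set_scope.
Local Open Scope ring_scope.

(* Functions on the torus are 1-periodic functions on R.  Functions of space and
   time are curried, with the space variable first. *)

Definition local_max (T : topologicalType) (R : realType) (g : T -> R) (a : T) :
    Prop :=
  \forall z \near a, g z <= g a.

Definition local_min (T : topologicalType) (R : realType) (g : T -> R) (a : T) :
    Prop :=
  \forall z \near a, g a <= g z.

Section Stationary.
Variable R : realType.
Implicit Types (G : R -> R -> R) (c : R) (v phi : R -> R).

Definition C1 phi : Prop :=
  (forall y, derivable phi y 1) /\ continuous (derive1 phi).

(* Viscosity sub- and supersolutions of G(y, Dv(y)) = c. *)

Definition stationary_subsolution G c v : Prop :=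
  forall phi y, C1 phi ->
    local_max (fun z => v z - phi z) y -> G y (derive1 phi y) <= c.

Definition stationary_supersolution G c v : Prop :=
  forall phi y, C1 phi ->
    local_min (fun z => v z - phi z) y -> c <= G y (derive1 phi y).

Definition stationary_solution G c v : Prop :=
  stationary_subsolution G c v /\ stationary_supersolution G c v.

(* [cell_solvable H x p c]: the equation H(x, y, p + Dv(y)) = c has a continuous
   periodic viscosity solution v. *)
Definition cell_solvable (H : R -> R -> R -> R) (x p c : R) : Prop :=
  exists v : R -> R, [/\ continuous v, periodic v 1 &
    stationary_solution (fun y q => H x y (p + q)) c v].

Definition effective_hamiltonian (H : R -> R -> R -> R) (Hbar : R -> R -> R) :
    Prop :=
  forall x p, cell_solvable H x p (Hbar x p) /\
    forall c, cell_solvable H x p c -> c = Hbar x p.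

End Stationary.

Section Evolution.
Variable R : realType.
Implicit Types (F u phi : R -> R -> R) (x t : R).

Definition partial_x phi x t : R := derive1 (fun z => phi z t) x.

Definition partial_t phi x t : R := derive1 (phi x) t.

(* Continuously differentiable on R x (0, oo). *)
Definition C1_pos phi : Prop :=
  forall x t, 0 < t ->
    [/\ derivable (fun z => phi z t) x 1,
        derivable (phi x) t 1,
        {for (x, t), continuous (fun z : R * R => partial_x phi z.1 z.2)} &
        {for (x, t), continuous (fun z : R * R => partial_t phi z.1 z.2)}].

(* Viscosity sub- and supersolutions of u_t + F(x, u_x) = 0 in R x (0, oo). *)

Definition evolution_subsolution F u : Prop :=
  forall phi x t, C1_pos phi -> 0 < t ->
    local_max (fun z : R * R => u z.1 z.2 - phi z.1 z.2) (x, t) ->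
    partial_t phi x t + F x (partial_x phi x t) <= 0.

Definition evolution_supersolution F u : Prop :=
  forall phi x t, C1_pos phi -> 0 < t ->
    local_min (fun z : R * R => u z.1 z.2 - phi z.1 z.2) (x, t) ->
    0 <= partial_t phi x t + F x (partial_x phi x t).

(* Bounded and uniformly continuous on R x [0, T] for every T > 0. *)
Definition BUC_strips u : Prop :=
  forall T : R, 0 < T ->
    (exists M : R, forall x t, 0 <= t <= T -> `|u x t| <= M) /\
    (forall e : R, 0 < e -> exists2 d : R, 0 < d &
      forall x t y s, 0 <= t <= T -> 0 <= s <= T ->
        `|x - y| < d -> `|t - s| < d -> `|u x t - u y s| < e).

Definition cauchy_solution F (u0 : R -> R) u : Prop :=
  [/\ BUC_strips u,
      (forall x, u x 0 = u0 x),
      evolution_subsolution F u &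
      evolution_supersolution F u].

End Evolution.

Section Example.
Variable R : realType.
Implicit Types x y p : R.

Definition f x : R := if `|x| <= 1 then `|x| `^ 4^-1 else 1.

(* y - floor (y + 1/2) is the representative of y modulo 1 in [-1/2, 1/2);
   see W_fundamental and W_periodic. *)
Definition W y : R := 2^-1 - `|y - (Num.floor (y + 2^-1))%:~R|.

Definition H x y p : R := - f x - W y + `|p| ^+ 2 / 2.

Lemma W_periodic : periodic W 1.
Proof.
move=> y; rewrite /W.
have -> : y + 1 + 2^-1 = (y + 2^-1) + 1%:~R :> R by rewrite mulr1z; ring.
by rewrite floorDrz ?intr_int// intrKfloor intrD mulr1z; congr (_ - `| _ |); ring.
Qed.

Lemma W_fundamental y : - 2^-1 <= y <= 2^-1 -> W y = 2^-1 - `|y|.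
Proof.
have W0 z : - 2^-1 <= z < 2^-1 -> W z = 2^-1 - `|z|.
  move=> /andP[z1 z2]; rewrite /W.
  have -> : Num.floor (z + 2^-1) = 0.
    by apply: floor_def; rewrite add0r mulr0z mulr1z; apply/andP; split; lra.
  by rewrite subr0.
move=> /andP[y1]; rewrite le_eqVlt => /predU1P[->|y2]; last first.
  by apply: W0; rewrite y1.
have -> : W 2^-1 = W (- 2^-1) by rewrite -(W_periodic (- 2^-1)); congr W; lra.
by rewrite W0 ?normrN//; apply/andP; split; lra.
Qed.

End Example.

(* Main.v *)
Require Import Defs.
From mathcomp Require Import all_boot all_order all_algebra.
From mathcomp Require Import all_classical all_reals all_analysis.
From mathcomp Require Import ring lra.
Import Order.TTheory GRing.Theory Num.Theory.
Import numFieldNormedType.Exports.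
Local Open Scope ring_scope.

(* The limit does not see the microstructure at the origin: testing the cell
   problem near y = 1/2, where W vanishes, gives Hbar(x, p) >= - f(x), hence
   u_t <= f(x) and u(0, 1) <= f(0) = 0.  For positive eps, W (x / eps) is bounded
   below when |x| <= eps / 4, and f(x) is at least of order eps^(1/4) otherwise;
   so f(x) + W (x / eps) >= eps^(1/4) / 4 everywhere, and t * eps^(1/4) / 8 is a
   strict subsolution of the oscillating problem, lying below u^eps.  Both
   comparisons are made by touching with a t + K x^2 + k t^N. *)

(** * Lower bound on the potential *)

Section Potential.
Variable R : realType.
Implicit Types x y p e : R.

Lemma W_ge0 y : 0 <= W y.
Proof.
rewrite /W; set z := Num.floor _.
have := floor_itv (y + 2^-1); rewrite -/z intrD mulr1z => /andP[z1 z2].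
by rewrite subr_ge0 ler_norml; apply/andP; split; lra.
Qed.

Lemma W_le_dist_half y : 0 <= y <= 1 -> W y <= `|y - 2^-1|.
Proof.
move=> /andP[y0 y1]; have [yh|yh] := leP y 2^-1.
  rewrite W_fundamental; last by apply/andP; split; lra.
  by rewrite ger0_norm// distrC ger0_norm; lra.
rewrite -[X in W X](subrK 1) W_periodic W_fundamental; last first.
  by apply/andP; split; lra.
by rewrite ler0_norm ?ger0_norm; lra.
Qed.

Lemma powR_quarterX4 x : 0 <= x -> (x `^ 4^-1) ^+ 4 = x.
Proof.
by move=> x0; rewrite -powR_mulrn ?powR_ge0// -powRrM mulVf ?powRr1// pnatr_eq0.
Qed.

Lemma ler_powR_quarter x y : 0 <= x -> x ^+ 4 <= y -> x <= y `^ 4^-1.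
Proof.
move=> x0 xy; rewrite -(@ler_pXn2r _ 4) ?nnegrE ?powR_ge0//.
by rewrite powR_quarterX4// (le_trans _ xy)// exprn_ge0.
Qed.

Lemma f_ge0 x : 0 <= f x.
Proof. by rewrite /f; case: ifP => // _; exact: powR_ge0. Qed.

Lemma potential_ge e x : 0 < e <= 1 -> e `^ 4^-1 / 4 <= f x + W (x / e).
Proof.
move=> /andP[e0 e1]; set q := e `^ 4^-1.
have q0 : 0 <= q by exact: powR_ge0.
have q4 : q ^+ 4 = e by apply: powR_quarterX4; exact: ltW.
have q1 : q <= 1 by rewrite -(@ler_pXn2r _ 4) ?nnegrE// q4 expr1n.
(* Inside this threshold [W (x / e)] is at least 1/4, hence at least [q / 4]. Outside it,
   [(q / 4) ^+ 4] is e/256, which is below e/4 and hence below |x|. *)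
have [xe|xe] := leP `|x| (e / 4).
  have xe4 : `|x / e| <= 4^-1.
    by rewrite normrM normfV (gtr0_norm e0) ler_pdivrMr// mulrC.
  rewrite W_fundamental; last first.
    by move: xe4; rewrite ler_norml => /andP[? ?]; apply/andP; split; lra.
  by have := f_ge0 x; lra.
have := W_ge0 (x / e); suff : q / 4 <= f x by lra.
rewrite /f; case: ifP => _; last by lra.
apply: ler_powR_quarter; first by lra.
by rewrite exprMn q4 (le_trans _ (ltW xe))// ler_pM2l//; lra.
Qed.

Lemma H_ge x y p : - f x - W y <= H x y p.
Proof. by rewrite /H lerDl divr_ge0// exprn_ge0. Qed.

End Potential.

(** * Test functions and touching points *)

Section Barrier.
Variable R : realType.
Implicit Types a K k x t : R.
Local Open Scope classical_set_scope.

Lemma is_derive_quad K c x :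
  is_derive x 1 (fun z : R => K * (z - c) ^+ 2) (K * (2 * (x - c))).
Proof.
apply: is_derive_eq; rewrite /GRing.scale/=; ring.
Qed.

(** The signs of [K] and [k] are left free, so the family serves for touching from above and from
    below. The exponent [n.+1] makes the last term vanish at time 0. *)
Definition barrier a K k n x t : R := a * t + K * x ^+ 2 + k * t ^+ n.+1.

Lemma is_derive_barrier_x a K k n x t :
  is_derive x 1 (fun z => barrier a K k n z t) (2 * K * x).
Proof.
rewrite /barrier; apply: is_derive_eq; rewrite /GRing.scale/=; ring.
Qed.

Lemma is_derive_barrier_t a K k n x t :
  is_derive t 1 (barrier a K k n x) (a + k * (n.+1%:R * t ^+ n)).
Proof.
have dX : is_derive t 1 (fun s : R => s ^+ n.+1) (n.+1%:R * t ^+ n).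
  have := @is_deriveX R R id n.+1 t 1 1 (is_derive_id _ _).
  by rewrite exprfctE /GRing.scale/= mulr1.
rewrite /barrier; apply: is_derive_eq; rewrite /GRing.scale/=; ring.
Qed.

Lemma partial_x_barrier a K k n x t :
  partial_x (barrier a K k n) x t = 2 * K * x.
Proof.
by rewrite /partial_x derive1E; apply: derive_val; exact: is_derive_barrier_x.
Qed.

Lemma partial_t_barrier a K k n x t :
  partial_t (barrier a K k n) x t = a + k * (n.+1%:R * t ^+ n).
Proof.
by rewrite /partial_t derive1E; apply: derive_val; exact: is_derive_barrier_t.
Qed.

Lemma continuous_fstX n : continuous (fun z : R * R => z.1 ^+ n).
Proof.
move=> z; apply: (@continuous_comp _ _ _ fst (fun s : R => s ^+ n)).
  exact: cvg_fst.
exact: exprn_continuous.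
Qed.

Lemma continuous_sndX n : continuous (fun z : R * R => z.2 ^+ n).
Proof.
move=> z; apply: (@continuous_comp _ _ _ snd (fun s : R => s ^+ n)).
  exact: cvg_snd.
exact: exprn_continuous.
Qed.

Lemma C1_pos_barrier a K k n : C1_pos (barrier a K k n).
Proof.
move=> x t _; split.
- by have [] := is_derive_barrier_x a K k n x t.
- by have [] := is_derive_barrier_t a K k n x t.
- rewrite /prop_for /continuous_at partial_x_barrier.
  under eq_fun do rewrite partial_x_barrier.
  by apply: cvgMr; exact: cvg_fst.
- rewrite /prop_for /continuous_at partial_t_barrier.
  under eq_fun do rewrite partial_t_barrier.
  apply: cvgD; [exact: cvg_cst|]; apply: cvgMr; apply: cvgMr.
  exact: continuous_sndX.
Qed.

(** The strip bounds say nothing about negative times, so continuity at t = 0 is relative to the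
    strip. *)
Lemma BUC_strips_within (w : R -> R -> R) (A : set R) (T : R) :
  BUC_strips w -> 0 < T ->
  {within A `*` `[0, T], continuous (fun z : R * R => w z.1 z.2)}.
Proof.
move=> hw T0; have [_ cw] := hw _ T0.
apply/subspace_continuousP => -[x t] /= [_]; rewrite in_itv/= => tT.
apply/cvgrPdist_lt => e e0; have [d d0 wd] := cw _ e0.
apply/nbhs_ballP; exists d => //= -[y s] [/= xy ts] [_/=].
by rewrite in_itv/= => sT; apply: wd.
Qed.

Lemma BUC_stripsN (w : R -> R -> R) :
  BUC_strips w -> BUC_strips (fun x t => - w x t).
Proof.
move=> hw T T0; have [[M wM] cw] := hw _ T0; split.
  by exists M => x t tT; rewrite normrN wM.
move=> e e0; have [d d0 wd] := cw _ e0; exists d => // x t y s tT sT xy ts.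
by rewrite -opprD normrN wd.
Qed.

(** The maximum over the compact rectangle is positive while [h] is nonpositive on all four sides,
    so it is attained in the open rectangle, a neighbourhood of the maximum point. *)
Lemma interior_local_max (h : R * R -> R) (L T x0 t0 : R) :
  {within `[- L, L] `*` `[0, T], continuous h} ->
  - L <= x0 <= L -> 0 <= t0 <= T -> 0 < h (x0, t0) ->
  (forall x, - L <= x <= L -> h (x, 0) <= 0 /\ h (x, T) <= 0) ->
  (forall t, 0 <= t <= T -> h (- L, t) <= 0 /\ h (L, t) <= 0) ->
  exists x t, [/\ - L < x < L, 0 < t < T, 0 < h (x, t) & local_max h (x, t)].
Proof.
move=> ch x0L t0T h0 ht hx.
have cA : compact (`[- L, L] `*` `[0, T] : set (R * R)).
  by apply: compact_setX; exact: segment_compact.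
have A0 : (`[- L, L] `*` `[0, T] : set (R * R)) (x0, t0).
  by split; rewrite /= in_itv.
have [|[x t] + hmax] := compact_EVT_max _ cA ch; first by exists (x0, t0).
rewrite inE => -[/=]; rewrite !in_itv/= => xL tT.
have hxt : 0 < h (x, t) by rewrite (lt_le_trans h0)// hmax// inE.
have xL' : - L < x < L.
  have [hl hr] := hx _ tT; case/andP: xL => xl xr.
  rewrite !lt_neqAle xl xr !andbT; apply/andP; split; apply/eqP => E.
    by move: hxt; rewrite -E ltNge hl.
  by move: hxt; rewrite E ltNge hr.
have tT' : 0 < t < T.
  have [hl hr] := ht _ xL; case/andP: tT => tl tr.
  rewrite !lt_neqAle tl tr !andbT; apply/andP; split; apply/eqP => E.
    by move: hxt; rewrite -E ltNge hl.
  by move: hxt; rewrite E ltNge hr.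
exists x, t; split => //.
exists (`]- L, L[, `]0, T[) => /=.
  by split => /=; apply: near_in_itvoo; rewrite in_itv.
move=> [y s] [/= yL sT]; apply: hmax; rewrite inE; split;
  exact: subset_itv_oo_cc.
Qed.

(* The power of t plays the role of a terminal penalisation: it is at most [k]
   at time 1, large at time 2, and only increases the time derivative. *)
Lemma barrier_touching (w : R -> R -> R) a k :
  BUC_strips w -> (forall x, w x 0 <= 0) -> 0 < k -> a + k < w 0 1 ->
  exists2 B : R, 0 <= B & forall K L, 0 < K -> 0 < L -> B <= K * L ^+ 2 ->
  exists n x t, [/\ - L < x < L, 0 < t, K * x ^+ 2 <= B &
    local_max (fun z : R * R => w z.1 z.2 - barrier a K k n z.1 z.2) (x, t)].
Proof.
move=> hw w0 k0 w1; have T0 : 0 < 2 :> R by [].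
have [[M wM] _] := hw _ T0.
have M0 : 0 <= M by rewrite (le_trans _ (wM 0 0 _))// lexx ltW.
(* [B] bounds [w x t - a * t] for times up to 2. It is fixed before [K] and [L], which can therefore
   be chosen in terms of it. *)
pose B := M + 2 * `|a|; have B0 : 0 <= B by rewrite addr_ge0// mulr_ge0.
exists B => // K L K0 L0 KL.
have waB x t : 0 <= t <= 2 -> w x t - a * t <= B.
  move=> tT; have wxt := le_trans (ler_norm _) (wM x t tT).
  have : - (a * t) <= 2 * `|a|.
    case/andP: tT => t0 t2.
    rewrite (le_trans (ler_norm _))// normrN normrM (ger0_norm t0) mulrC.
    exact: ler_wpM2r.
  rewrite /B; lra.
have [n Bn] : exists n, B <= k * 2 ^+ n.+1.
  exists (Num.bound (B / k)); rewrite mulrC -ler_pdivrMr//.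
  apply: (le_trans (ltW (archi_boundP _))).
    by rewrite divr_ge0// ltW.
  by rewrite -natrX ler_nat ltnW// ltnW// ltn_expl.
have kt_ge0 t : 0 <= t -> 0 <= k * t ^+ n.+1.
  by move=> t0; rewrite mulr_ge0 ?exprn_ge0// ltW.
have Kx_ge0 x : 0 <= K * x ^+ 2 by rewrite mulr_ge0 ?sqr_ge0 ?ltW.
pose h (z : R * R) := w z.1 z.2 - barrier a K k n z.1 z.2.
(* [h] is positive at (0, 1) because a + k < w(0, 1). The choice of [n] handles the side t = 2, and
   B <= K L^2 the lateral sides. *)
have [||||||x [t [xL /andP[t0 t2] hxt hmax]]] := @interior_local_max h L 2 0 1.
- move=> z; apply: cvgB; first exact: BUC_strips_within.
  apply: (@continuous_subspaceT _ _ _ (fun z => barrier a K k n z.1 z.2)).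
  move=> {}z; apply: cvgD; first apply: cvgD.
  + by apply: cvgMr; exact: cvg_snd.
  + by apply: cvgMr; exact: continuous_fstX.
  + by apply: cvgMr; exact: continuous_sndX.
- by apply/andP; split; lra.
- by apply/andP; split; lra.
- by rewrite /h /barrier/= expr1n; lra.
- move=> x _; rewrite /h /barrier/= expr0n/=; split.
    by have := w0 x; have := Kx_ge0 x; lra.
  have := Kx_ge0 x; have : w x 2 - a * 2 <= B by rewrite waB// lexx ltW.
  by lra.
- move=> t tT; rewrite /h /barrier/= sqrrN; case/andP: (tT) => t0 _.
  by have := kt_ge0 _ t0; have := waB L t tT; have := waB (- L) t tT; lra.
(* Positivity of [h] at the touching point gives K x^2 <= B. *)
exists n, x, t; split => //; move: hxt; rewrite /h /barrier/=.
have : w x t - a * t <= B by rewrite waB// !ltW.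
by have := kt_ge0 _ (ltW t0); lra.
Qed.

End Barrier.

(** * Bounds on the effective Hamiltonian and on both solutions *)

Section Bounds.
Variable R : realType.
Implicit Types x p : R.
Local Open Scope classical_set_scope.

Lemma C1_quad (K c : R) : C1 (fun z : R => K * (z - c) ^+ 2).
Proof.
split=> [y|]; first by have [] := is_derive_quad R K c y.
have -> : derive1 (fun z : R => K * (z - c) ^+ 2) = fun y => K * (2 * (y - c)).
  apply/funext => y; rewrite derive1E; apply: derive_val.
  exact: is_derive_quad.
move=> y; apply: cvgMr; apply: cvgMr.
by apply: cvgB; [exact: cvg_id|exact: cvg_cst].
Qed.

(* Touching v from above by steep parabolas centred at y0 gives test points
   arbitrarily close to y0. *)
Lemma stationary_subsolution_ge (G : R -> R -> R) c v y0 r m :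
  continuous v -> stationary_subsolution G c v -> 0 < r ->
  (forall y q, `|y - y0| < r -> m <= G y q) -> m <= c.
Proof.
move=> cv vsub r0 mG.
have [z _ vz] : exists2 z, z \in `[y0 - r, y0 + r]%R &
    forall y, y \in `[y0 - r, y0 + r]%R -> v y <= v z.
  by apply: EVT_max; [lra|exact: continuous_subspaceT].
(* At distance [r] the parabola exceeds the rise max v - v(y0) by 1, so the maximum of the
   difference avoids the endpoints. *)
pose K := (v z - v y0 + 1) / r ^+ 2.
have Kr : K * r ^+ 2 = v z - v y0 + 1 by rewrite divfK// expf_neq0// gt_eqF.
have [||y yI ymax] := @EVT_max R (fun s => v s - K * (s - y0) ^+ 2)
  (y0 - r) (y0 + r); first by lra.
- apply: continuous_subspaceT => s; apply: cvgB; first exact: cv.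
  by have [/(_ s)/derivable1_diffP/differentiable_continuous] := C1_quad K y0.
have : v y0 <= v y - K * (y - y0) ^+ 2.
  have /ymax : y0 \in `[y0 - r, y0 + r]%R.
    by rewrite in_itv/=; apply/andP; split; lra.
  by rewrite subrr expr0n/= mulr0 subr0.
have := vz _ yI; move: (yI); rewrite in_itv/= => /andP[yl yr] vyz vy.
have yI' : y \in `]y0 - r, y0 + r[%R.
  rewrite in_itv/= !lt_neqAle yl yr !andbT; apply/andP; split; apply/eqP => E.
    by move: vy; rewrite -E addrAC subrr add0r sqrrN Kr E; lra.
  by move: vy; rewrite E addrAC subrr add0r Kr -E; lra.
have ymax' : local_max (fun s => v s - K * (s - y0) ^+ 2) y.
  have := near_in_itvoo yI'; apply: filterS => s /subset_itv_oo_cc; exact: ymax.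
apply: le_trans (vsub _ _ (C1_quad K y0) ymax'); apply: mG.
by move: yI'; rewrite in_itv/= ltr_distl.
Qed.

Lemma effective_hamiltonian_ge (Hbar : R -> R -> R) x p :
  effective_hamiltonian (@H R) Hbar -> - f x <= Hbar x p.
Proof.
move=> /(_ x p)[[v [cv _ [vsub _]]] _].
apply/ler_addgt0Pr => e e0; rewrite -lerBlDr.
(* r <= e gives W <= e near 1/2; r <= 1/2 keeps y in [0, 1]. *)
pose r := Num.min e 2^-1; have r0 : 0 < r by rewrite lt_min e0/= invr_gt0.
apply: (@stationary_subsolution_ge _ _ _ 2^-1 r _ cv vsub r0) => y q yr.
apply: le_trans (H_ge R x y (p + q)).
move: yr; rewrite lt_min => /andP[ye yh].
move: yh; rewrite ltr_norml => /andP[y1 y2].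
have : W y <= `|y - 2^-1| by apply: W_le_dist_half; apply/andP; split; lra.
lra.
Qed.

(** If u(0, 1) > 0, a barrier of slope [a] touches [u] from above at a point so close to the origin
    that f <= a/2, whereas the subsolution test there forces a <= f. *)
Lemma limit_le0 (Hbar u : R -> R -> R) :
  (forall x p, - f x <= Hbar x p) ->
  BUC_strips u -> (forall x, u x 0 = 0) -> evolution_subsolution Hbar u ->
  u 0 1 <= 0.
Proof.
move=> HbarE hu u0 usub; rewrite leNgt; apply/negP => s0.
set s := u 0 1 in s0; pose a := Num.min (s / 4) 1.
have a0 : 0 < a by rewrite lt_min ltr01 divr_gt0.
have [as4 a1] : a <= s / 4 /\ a <= 1 by rewrite !ge_min !lexx orbT.
have [|||B B0] := @barrier_touching R u a (s / 4) hu _ _ _.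
- by move=> x; rewrite u0.
- by rewrite divr_gt0.
- by rewrite -/s; lra.
(* |x| < L <= 1 then yields f(x) <= a/2; a large [K] confines the touching point to this small
   interval. *)
pose L := (a / 2) ^+ 4.
have L0 : 0 < L by rewrite exprn_gt0// divr_gt0.
pose K := (B + 1) / L ^+ 2.
have KL : K * L ^+ 2 = B + 1 by rewrite divfK// expf_neq0// gt_eqF.
have K0 : 0 < K by rewrite divr_gt0 ?exprn_gt0//; lra.
move=> /(_ K L K0 L0); rewrite KL => -[|n [x [t [xL t0 _ hmax]]]]; first by lra.
have := usub _ _ _ (C1_pos_barrier R a K (s / 4) n) t0 hmax.
rewrite partial_t_barrier partial_x_barrier.
have := HbarE x (2 * K * x).
have : 0 <= s / 4 * (n.+1%:R * t ^+ n).
  by rewrite mulr_ge0 ?divr_ge0 ?mulr_ge0 ?exprn_ge0// ltW.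
suff : f x <= a / 2 by lra.
have xL' : `|x| < L by rewrite ltr_norml.
have L1 : L <= 1 by rewrite exprn_ile1//; lra.
rewrite /f (le_trans (ltW xL') L1).
rewrite -(@ler_pXn2r _ 4) ?nnegrE ?powR_ge0//; last lra.
by rewrite powR_quarterX4// ltW.
Qed.

(** If w(0, 1) < m', a barrier of slope [m'] touches [w] from below, and the test gives m <= m' + 2
    K B, which fails for small [K]. *)
Lemma supersolution_ge (V : R -> R) (w : R -> R -> R) m m' :
  0 < m' < m -> (forall x, m <= V x) ->
  BUC_strips w -> (forall x, w x 0 = 0) ->
  evolution_supersolution (fun x p => - V x + `|p| ^+ 2 / 2) w ->
  m' <= w 0 1.
Proof.
move=> /andP[m'0 mm'] Vm hw w0 wsup; rewrite leNgt; apply/negP => w1.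
pose k := (m' - w 0 1) / 2; have k0 : 0 < k by rewrite /k; lra.
have [||B B0] := @barrier_touching R _ (- m') k (BUC_stripsN R w hw) _ k0 _.
- by move=> x; rewrite w0 oppr0.
- by rewrite /k; lra.
(* This makes 2 K B smaller than m - m'. Here [K] is small and [L] large: a small gradient is
   wanted, not a small |x|. *)
pose K := (m - m') / (4 * (B + 1)).
have K0 : 0 < K by rewrite divr_gt0//; lra.
have KB : K * (4 * (B + 1)) = m - m' by rewrite divfK//; lra.
pose L := B / K + 1.
have L0 : 0 < L by rewrite ltr_wpDl// divr_ge0// ltW.
have L1 : 1 <= L by rewrite lerDr divr_ge0// ltW.
have LL : L <= L ^+ 2 by rewrite expr2 ler_peMl// ltW.
move=> /(_ K L K0 L0)[|n [x [t [_ t0 xB hmax]]]].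
  by rewrite mulrC -ler_pdivrMr// (le_trans _ LL)// lerDl.
have hmin : local_min (fun z : R * R =>
    w z.1 z.2 - barrier R m' (- K) (- k) n z.1 z.2) (x, t).
  apply: filterS hmax => z /=; rewrite /barrier; lra.
have := wsup _ _ _ (C1_pos_barrier R m' (- K) (- k) n) t0 hmin.
rewrite partial_t_barrier partial_x_barrier.
have : 0 <= k * (n.+1%:R * t ^+ n).
  by rewrite mulr_ge0 ?(ltW k0)// mulr_ge0// exprn_ge0// ltW.
have := Vm x; rewrite real_normK ?num_real//.
(* The kinetic term is written through K x^2, which is at most [B] wherever the touching point
   lies. *)
have -> : (2 * - K * x) ^+ 2 / 2 = 2 * K * (K * x ^+ 2) by field.
have : 2 * K * (K * x ^+ 2) <= 2 * K * B.
  by rewrite ler_wpM2l// mulr_ge0// ltW.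
nra.
Qed.

End Bounds.

Theorem proposition4p2 (R : realType) (Hbar : R -> R -> R) (u : R -> R -> R)
    (hHbar : effective_hamiltonian (@H R) Hbar)
    (hu : cauchy_solution Hbar (fun _ : R => 0) u)
    (eps : R) (heps : 0 < eps < 2 ^- 80)
    (ueps : R -> R -> R)
    (hueps : cauchy_solution (fun x p : R => H x (x / eps) p)
               (fun _ : R => 0) ueps) :
  ueps 0 1 - u 0 1 >= 32^-1 * eps `^ 4^-1.
Proof.
have [hu1 hu2 hu3 _] := hu; have [hw1 hw2 _ hw4] := hueps.
case/andP: heps => eps0 epsl.
have eps1 : eps <= 1.
  by rewrite (le_trans (ltW epsl))// invf_le1 ?exprn_gt0// exprn_ege1// ler1n.
have u_le0 : u 0 1 <= 0.
  by apply: limit_le0 hu1 hu2 hu3 => x p; exact: effective_hamiltonian_ge.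
set q := eps `^ 4^-1; have q0 : 0 < q by exact: powR_gt0.
(* The comparison asks for a rate strictly below the potential bound q/4; q/8 is one, and it exceeds
   q/32. *)
suff : q / 8 <= ueps 0 1 by lra.
apply: (@supersolution_ge R (fun x => f x + W (x / eps)) _ (q / 4)) => //.
- by apply/andP; split; lra.
- by move=> x; apply: potential_ge; rewrite eps0.
- have <- : (fun x p : R => H x (x / eps) p) =
      (fun x p => - (f x + W (x / eps)) + `|p| ^+ 2 / 2); last by [].
  by apply/funext => x; apply/funext => p; rewrite /H -opprD.
Qed.
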